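(* For any prime power $q$, let $\Phi(z)$ be the $[(q+1)\times q]\times(q\times q)$ block matrix (rows indexed by pairs $(i,x)$ with $i\in\mathbb{F}_q\cup\{\infty\}$, $x\in\mathbb{F}_q$; columns indexed by pairs $(j,y)$ with $j,y\in\mathbb{F}_q$), whose entries are polynomials over the additive group of the finite field $\mathbb{F}_q$, where the $(x,y)$th entry of the $(i,j)$th block is $$\Phi(z;i,j;x,y):=\begin{cases} z^{j(x+y)}, & x-y=ij,\ i\neq\infty,\\ 1, & x=j,\ i=\infty,\\ 0,&\text{else.}\end{cases}$$ Then $\Phi(z)$ is a $(q^2,q,q)$-polyphase BIBD ETF. As such: (a) For any nontrivial character $\gamma$ of the additive group of $\mathbb{F}_q$, $|\Phi(\gamma)|^2$ is the incidence matrix of a $\mathrm{BIBD}(q^2,q,1)$ and the columns of $\Phi(\gamma)$ form an ETF of $n$ vectors for their $d$-dimensional span, where $d=\binom{q+1}{2}$, $n=q^2$, $n-d=\binom q2$. (b) When $q=2^j$ for some positive integer $j$, $\gamma$ can be chosen so that $\Phi(\gamma)$ is a real ETF. (c) $\Phi^*(z)\Phi(z)-(q+1)I$ is an abelian $(q^2,q,q)$-DRACKN. (d) The matrix $Z=\begin{bmatrix} I_{q^2}\otimes\mathbf{1}_q^{\mathrm T}\\ \Phi(T)\end{bmatrix}$ is the incidence matrix of an abelian $\mathrm{GQ}(q-1,q+1)$.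
   Context: **Polyphase matrices.** For a finite abelian group $\mathcal{G}$ (written additively), elements of the group ring $\mathbb{C}\mathcal{G}$ are written as formal polynomials $x(z)=\sum_{g\in\mathcal{G}}x(g)z^g$ with $x(g)\in\mathbb{C}$, multiplied by $z^{g_1}z^{g_2}=z^{g_1+g_2}$; the multiplicative identity is $1=z^0$. A monomial over $\mathcal{G}$ is an element $z^g$. The conjugate of $x(z)$ is $\overline{x(z)}:=\sum_{g}\overline{x(-g)}z^g$. A polyphase matrix over $\mathcal{G}$ is a matrix with entries in $\mathbb{C}\mathcal{G}$; $\Phi^*(z)$ is the matrix whose $(j,i)$ entry is the conjugate of the $(i,j)$ entry of $\Phi(z)$, and self-adjoint means $A^*(z)=A(z)$. $|\Phi(z)|^2$ is the matrix whose entries are $\overline{x(z)}x(z)$, where $x(z)$ is the corresponding entry of $\Phi(z)$; for a complex matrix, $|\cdot|^2$ is the entrywise squared modulus. Scalar matrices are regarded as polyphase matrices with constant entries. A character of $\mathcal{G}$ is a homomorphism $\gamma:\mathcal{G}\to\{\zeta\in\mathbb{C}:|\zeta|=1\}$; $x(\gamma):=\sum_g x(g)\gamma(g)$, and $\Phi(\gamma)$ is obtained by applying this entrywise. For $g\in\mathcal{G}$, $T^g$ is the $\mathcal{G}\times\mathcal{G}$ permutation matrix of the translation $(T^g y)(g')=y(g'-g)$ on $\mathbb{C}^{\mathcal{G}}$. $\Phi(T)$ is the block matrix obtained from $\Phi(z)$ by replacing each entry $\sum_g x(g)z^g$ by the $|\mathcal{G}|\times|\mathcal{G}|$ block $\sum_g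 x(g)T^g$. $\mathbf{1}_k$ is the $k\times1$ all-ones vector. **BIBD.** For integers $v>k\geq 2$, a $\mathrm{BIBD}(v,k,1)$ is a $v$-element vertex set with a collection of $b$ subsets (blocks) such that every block contains exactly $k$ vertices and every pair of distinct vertices is in exactly one block. Its incidence matrix is $b\times v$ with rows indexed by blocks and columns by vertices. **ETF.** Vectors $\varphi_1,\dots,\varphi_n\in\mathbb{C}^m$ form an equiangular tight frame (ETF) for their span $H$ if they are nonzero with equal norms, there is $w$ with $|\langle\varphi_i,\varphi_j\rangle|=w$ for all $i\neq j$, and there is $a>0$ with $\sum_i\langle\varphi_i,x\rangle\varphi_i=ax$ for all $x\in H$ (inner product conjugate-linear in the first argument). ''$\Phi(\gamma)$ is a real ETF'' means the entries of $\Phi(\gamma)$ are real and its columns form an ETF for their span ($\gamma$ nontrivial). **Polyphase BIBD ETF.** Let $\mathcal{G}$ be an abelian group of order $f$. A polyphase matrix $\Phi(z)$ whose entries are monomials over $\mathcal{G}$ or zero is a $(v,k,f)$-polyphase BIBD ETF if $|\Phi(z)|^2$ is the incidence matrix of a $\mathrm{BIBD}(v,k,1)$ and, for all nontrivial characters $\gamma$ of $\mathcal{G}$, the columns of $\Phi(\gamma)$ form an ETF for their span. **Abelian DRACKN.** For positive integers $n,f,c$ with $f\geq 2$ and an abelian group $\mathcal{G}$ of order $f$, an abelian $(n,f,c)$-DRACKN is a self-adjoint $n\times n$ polyphase matrix $A(z)$ over $\mathcal{G}$ whose diagonal entries are zero, whose off-diagonal entries are monomials, and which satisfies $[A(z)]^2=(n-fc-2)A(z)+(n-1)I+c\,\mathbf{1}(z)(J-I)$,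 where $\mathbf{1}(z)=\sum_{g\in\mathcal{G}}z^g$ and $J$ is the all-ones matrix. **Generalized quadrangle.** For positive integers $s,t$, a $\mathrm{GQ}(s,t)$ is a set of vertices and a set of blocks (subsets of the vertex set) such that: every block contains exactly $s+1$ vertices; every vertex is in exactly $t+1$ blocks; two distinct blocks intersect in at most one vertex; two distinct vertices are contained in at most one block; and if vertex $i$ does not lie in block $j$, there is a unique pair $(i',j')$ such that vertex $i'$ is in blocks $j$ and $j'$ and block $j'$ contains both vertices $i$ and $i'$. Its incidence matrix has rows indexed by blocks and columns by vertices, with entry $1$ iff the vertex is in the block. A $\mathrm{GQ}(s,t)$ is abelian if it has an incidence matrix of the form $\begin{bmatrix} I_{st+1}\otimes\mathbf{1}_{s+1}^{\mathrm T}\\ \Phi(T)\end{bmatrix}$ where $\Phi(z)$ is an $(st+1,s+1,s+1)$-polyphase BIBD ETF. *)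

(* Defs.v *)
From HB Require Import structures.
From mathcomp Require Import all_boot all_order all_algebra.
From mathcomp Require Import mxtens.

Set Implicit Arguments.
Unset Strict Implicit.
Unset Printing Implicit Defensive.

Import Order.TTheory GRing.Theory Num.Theory.
Local Open Scope ring_scope.

(* The element x represents the formal polynomial \sum_g x(g) z^g.  This alias
   hides the pointwise ring structure that {ffun G -> C} has canonically: the
   product of groupring C G is the convolution. *)
Definition groupring (C : comNzRingType) (G : finZmodType) : Type :=
  {ffun G -> C}.

Section GroupRing.
Variables (C : comNzRingType) (G : finZmodType).
Local Notation CG := (groupring C G).

Definition gcoef (x : CG) (g : G) : C := (x : {ffun G -> C}) g.

Definition gmono (g : G) : CG := [ffun h => (h == g)%:R].

Definition gmul (x y : CG) : CG :=
  [ffun g => \sum_h gcoef x h * gcoef y (g - h)].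

HB.instance Definition _ := GRing.Zmodule.copy CG {ffun G -> C}.

Lemma gcoef_inj (x y : CG) : gcoef x =1 gcoef y -> x = y.
Proof. by move=> exy; apply/ffunP. Qed.

Lemma gcoefD (x y : CG) g : gcoef (x + y) g = gcoef x g + gcoef y g.
Proof. by rewrite /gcoef ffunE. Qed.

Lemma gcoefM (x y : CG) g :
  gcoef (gmul x y) g = \sum_h gcoef x h * gcoef y (g - h).
Proof. by rewrite /gcoef ffunE. Qed.

Lemma gcoef_mono (a g : G) : gcoef (gmono a) g = (g == a)%:R.
Proof. by rewrite /gcoef ffunE. Qed.

Lemma gmulC : commutative gmul.
Proof.
move=> x y; apply: gcoef_inj => g; rewrite !gcoefM.
rewrite (reindex_inj (inj_comp (addrI g) oppr_inj)) /=.
by apply: eq_bigr => h _; rewrite mulrC opprB addrC subrK.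
Qed.

Lemma gmulA : associative gmul.
Proof.
move=> x y z; apply: gcoef_inj => g; rewrite !gcoefM.
under eq_bigr => h _ do rewrite gcoefM mulr_sumr.
under [RHS]eq_bigr => h _ do rewrite gcoefM mulr_suml.
rewrite [RHS]exchange_big /=; apply: eq_bigr => h _.
rewrite [RHS](reindex_inj (addIr h)) /=; apply: eq_bigr => k _.
by rewrite mulrA addrK opprD addrA addrAC.
Qed.

Lemma gmul1 : left_id (gmono 0) gmul.
Proof.
move=> x; apply: gcoef_inj => g; rewrite gcoefM (bigD1 0) //= gcoef_mono eqxx.
rewrite mul1r subr0 big1 ?addr0 // => h /negbTE h0.
by rewrite gcoef_mono h0 mul0r.
Qed.

Lemma gmulDl : left_distributive gmul +%R.
Proof.
move=> x y z; apply: gcoef_inj => g; rewrite gcoefD !gcoefM -big_split /=.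
by apply: eq_bigr => h _; rewrite gcoefD mulrDl.
Qed.

Lemma gone_neq0 : gmono 0 != 0 :> CG.
Proof.
apply/eqP => /(congr1 (gcoef^~ 0)); rewrite gcoef_mono eqxx /gcoef ffunE.
by move/eqP; rewrite oner_eq0.
Qed.

HB.instance Definition _ :=
  GRing.Zmodule_isComNzRing.Build CG gmulA gmulC gmul1 gmulDl gone_neq0.

End GroupRing.

Arguments gmono {C G} g.

Definition gmonomial (C : comNzRingType) (G : finZmodType)
  (x : groupring C G) : Prop := exists g, x = gmono g.

Section Polyphase.
Variables (C : numClosedFieldType) (G : finZmodType).
Local Notation CG := (groupring C G).

Definition gconj (x : CG) : CG := [ffun g => Num.conj (gcoef x (- g))].

Definition geval (gamma : G -> C) (x : CG) : C :=
  \sum_g gcoef x g * gamma g.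

Definition is_character (gamma : G -> C) : Prop :=
  (forall g, `|gamma g| = 1) /\
  (forall g h, gamma (g + h) = gamma g * gamma h).

Definition nontrivial_character (gamma : G -> C) : Prop :=
  is_character gamma /\ exists g, gamma g <> 1.

Definition adjmx m n (Phi : 'M[CG]_(m, n)) : 'M[CG]_(n, m) :=
  \matrix_(j, i) gconj (Phi i j).

Definition psqmx m n (Phi : 'M[CG]_(m, n)) : 'M[CG]_(m, n) :=
  map_mx (fun x => gconj x * x) Phi.

Definition evalmx m n (gamma : G -> C) (Phi : 'M[CG]_(m, n)) : 'M[C]_(m, n) :=
  map_mx (geval gamma) Phi.

(* C^G is identified with C^#|G| through the enumeration of G. *)
Definition transmx (g : G) : 'M[C]_#|G| :=
  \matrix_(a, b) (enum_val b == enum_val a - g)%:R.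

Definition gtransmx (x : CG) : 'M[C]_#|G| :=
  \sum_g gcoef x g *: transmx g.

(* mxtens_unindex splits a row (or column) index of the block matrix into the
   index of the block and the index inside the block. *)
Definition blockmx m n (Phi : 'M[CG]_(m, n)) : 'M[C]_(m * #|G|, n * #|G|) :=
  \matrix_(r, c)
    gtransmx (Phi (mxtens_unindex r).1 (mxtens_unindex c).1)
      (mxtens_unindex r).2 (mxtens_unindex c).2.

Definition GQmx m n (Phi : 'M[CG]_(m, n)) :
    'M[C]_(n * 1 + m * #|G|, n * #|G|) :=
  col_mx ((1%:M : 'M[C]_n) *t (const_mx 1 : 'rV[C]_#|G|)) (blockmx Phi).

End Polyphase.

Definition sqmx (C : numClosedFieldType) m n (M : 'M[C]_(m, n)) :
    'M[C]_(m, n) :=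
  map_mx (fun x => `|x| ^+ 2) M.

(* bl and vx are the enumerations of the blocks and of the vertices that index
   the rows and the columns. *)
Definition is_incidence_matrix (R : nzRingType) m n (M : 'M[R]_(m, n))
    (V : finType) (Bs : {set {set V}}) : Prop :=
  exists (bl : 'I_m -> {set V}) (vx : 'I_n -> V),
    [/\ injective bl, [set bl i | i : 'I_m] = Bs, bijective vx
      & forall i j, M i j = (vx j \in bl i)%:R].

Definition is_BIBD (V : finType) (Bs : {set {set V}}) (v k : nat) : Prop :=
  [/\ (2 <= k < v)%N, #|V| = v,
      forall B, B \in Bs -> #|B| = k
    & forall x y : V, x <> y ->
        #|[set B in Bs | (x \in B) && (y \in B)]| = 1%N].

Definition BIBD_incidence (R : nzRingType) m n (M : 'M[R]_(m, n))
    (v k : nat) : Prop :=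
  exists (V : finType) (Bs : {set {set V}}),
    is_BIBD Bs v k /\ is_incidence_matrix M Bs.

Section ETF.
Variable C : numClosedFieldType.

Definition cdot m (u v : 'cV[C]_m) : C :=
  \sum_i Num.conj (u i 0) * v i 0.

Definition cnorm m (u : 'cV[C]_m) : C := sqrtC (cdot u u).

Definition is_ETF m n (M : 'M[C]_(m, n)) : Prop :=
  [/\ forall i, col i M <> 0,
      forall i j, cnorm (col i M) = cnorm (col j M),
      exists w : C, forall i j, i <> j -> `|cdot (col i M) (col j M)| = w
    & exists2 a : C, 0 < a &
        forall x : 'cV[C]_m, (x^T <= M^T)%MS ->
          \sum_i cdot (col i M) x *: col i M = a *: x].

Definition is_real_ETF m n (M : 'M[C]_(m, n)) : Prop :=
  (forall i j, M i j \is Num.real) /\ is_ETF M.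

End ETF.

Definition polyphase_BIBD_ETF (C : numClosedFieldType) (v k f : nat)
    (G : finZmodType) m n (Phi : 'M[groupring C G]_(m, n)) : Prop :=
  [/\ #|G| = f,
      forall i j, gmonomial (Phi i j) \/ Phi i j = 0,
      BIBD_incidence (psqmx Phi) v k
    & forall gamma : G -> C, nontrivial_character gamma ->
        is_ETF (evalmx gamma Phi)].

Definition abelian_DRACKN (C : numClosedFieldType) (n f c : nat)
    (G : finZmodType) N (A : 'M[groupring C G]_N) : Prop :=
  [/\ [/\ N = n, (0 < n)%N, (2 <= f)%N, (0 < c)%N & #|G| = f],
      adjmx A = A,
      forall i, A i i = 0,
      forall i j, i <> j -> gmonomial (A i j)
    & A *m A = (n%:R - (f * c)%:R - 2%:R) *: A + (n%:R - 1)%:M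
               + (c%:R * \sum_(g : G) gmono g) *: (const_mx 1 - 1%:M)].

Definition is_GQ (V : finType) (Bs : {set {set V}}) (s t : nat) : Prop :=
  [/\ (0 < s)%N && (0 < t)%N,
      forall B, B \in Bs -> #|B| = s.+1,
      forall x : V, #|[set B in Bs | x \in B]| = t.+1,
      (forall B B', B \in Bs -> B' \in Bs -> B <> B' ->
         (#|B :&: B'| <= 1)%N) /\
      (forall x y : V, x <> y ->
         (#|[set B in Bs | (x \in B) && (y \in B)]| <= 1)%N)
    & forall (x : V) B, B \in Bs -> x \notin B ->
        exists! p : V * {set V},
          [/\ p.2 \in Bs, p.1 \in B, p.1 \in p.2 & x \in p.2]].

Definition is_abelian_GQ (C : numClosedFieldType) (V : finType)
    (Bs : {set {set V}}) (s t : nat) : Prop :=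
  is_GQ Bs s t /\
  exists (G : finZmodType) (m n : nat) (Phi : 'M[groupring C G]_(m, n)),
    polyphase_BIBD_ETF (s * t + 1) (s + 1) (s + 1) Phi /\
    is_incidence_matrix (GQmx Phi) Bs.

(* i = None stands for i = infinity. *)
Definition Phientry (C : numClosedFieldType) (F : finFieldType)
    (r : option F * F) (c : F * F) : groupring C F :=
  let: (oi, x) := r in
  let: (j, y) := c in
  if oi is Some i then
    if x - y == i * j then gmono (j * (x + y)) else 0
  else if x == j then 1 else 0.

Definition Phimx (C : numClosedFieldType) (F : finFieldType) :
    'M[groupring C F]_(#|{: option F * F}|, #|{: F * F}|) :=
  \matrix_(r < #|{: option F * F}|, c < #|{: F * F}|)
    Phientry C (enum_val r) (enum_val c).

(* Main.v *)
Require Import Defs.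
From mathcomp Require Import all_boot all_order all_algebra.
From mathcomp Require Import reals complex.
From mathcomp Require Import finfield mxtens ring.

Set Implicit Arguments.
Unset Strict Implicit.
Unset Printing Implicit Defensive.

Import Order.TTheory GRing.Theory Num.Theory.
Local Open Scope ring_scope.

(** Two distinct points c = (j, y), c' = (j', y') of the affine plane lie on
    exactly one common line, and there the phases of Phi differ by the exponent
    (j' - j)(y + y').  Hence Phi^* Phi = E + q I, where E is the matrix of the
    monomials z^((j' - j)(y + y')), diagonal included.  Summing geometric sums,
    E^2 = q^2 I + q 1(z) (J - I); this is the DRACKN equation for A = E - I, and
    at a nontrivial character, where 1(z) vanishes, the Gram matrix G satisfies
    G^2 = 2 q G, so that the columns form an ETF of dimension tr G / 2q.
    For the quadrangle, (c, b) and (c', b') are collinear iff c = c' or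
    b - b' = (j' - j)(y + y'); on a block missing (c, b) this is a linear
    equation with a single solution.  In characteristic 2 the absolute trace
    x |-> sum_i x^(2^i) is onto F_2, and its sign is a real character. *)

(** * Rank and tight frames read off from Gram matrices *)

Lemma mxrank_idem (K : fieldType) n (P : 'M[K]_n) :
  P *m P = P -> (\rank P)%:R = \tr P.
Proof.
move=> PP; have: col_base P *m ((row_base P *m col_base P) *m row_base P)
                 = col_base P *m row_base P.
  by rewrite mulmxA mulmxA -mulmxA !mulmx_base.
move/(row_full_inj (col_base_full P)); rewrite -[X in _ = X]mul1mx.
move/(row_free_inj (row_base_free P)) => rc1.
by rewrite -[in RHS](mulmx_base P) mxtrace_mulC rc1 mxtrace1.
Qed.

Section GramMatrix.
Variable C : numClosedFieldType.

Definition conjtr m n (M : 'M[C]_(m, n)) : 'M[C]_(n, m) := map_mx Num.conj M^T.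

Lemma conjtrM m n p (M : 'M[C]_(m, n)) (N : 'M[C]_(n, p)) :
  conjtr (M *m N) = conjtr N *m conjtr M.
Proof. by rewrite /conjtr trmx_mul map_mxM. Qed.

Lemma conjtrK m n : cancel (@conjtr m n) (@conjtr n m).
Proof. by move=> M; apply/matrixP => i j; rewrite !mxE conjCK. Qed.

(** The diagonal entries of M^* M are the squared norms of the columns of M. *)
Lemma conjtr_mul_eq0 m n (M : 'M[C]_(m, n)) : conjtr M *m M = 0 -> M = 0.
Proof.
move=> M0; apply/matrixP => i j; move/matrixP: M0 => /(_ j j).
rewrite !mxE => /psumr_eq0P M0; apply/eqP; rewrite -normr_eq0 -sqrf_eq0.
rewrite normCK mulrC; have := M0 _ i isT; rewrite !mxE => -> // k _.
by rewrite !mxE mulrC -normCK exprn_ge0.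
Qed.

Lemma cdot_col m n (M : 'M[C]_(m, n)) i j :
  cdot (col i M) (col j M) = (conjtr M *m M) i j.
Proof. by rewrite /cdot !mxE; apply: eq_bigr => k _; rewrite !mxE. Qed.

(** For D = M(G - a), with a real, D^* D = (G - a) G (G - a) = 0, so D = 0. This passes from the
    Gram matrix to the frame operator M M^*. *)
Lemma gram_sq m n (M : 'M[C]_(m, n)) (a : C) : a \is Num.real ->
  let G := conjtr M *m M in G *m G = a *: G -> M *m G = a *: M.
Proof.
move=> ar G GG; apply/eqP; rewrite -subr_eq0; apply/eqP/conjtr_mul_eq0.
have Gh : conjtr G = G by rewrite conjtrM conjtrK.
have -> : conjtr (M *m G - a *: M) = (G - a%:M) *m conjtr M.
  rewrite -mul_mx_scalar -mulmxBr conjtrM; congr (_ *m _).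
  rewrite -[in RHS]Gh; apply/matrixP => i j; rewrite !mxE rmorphB rmorphMn /=.
  by rewrite [j == i]eq_sym (CrealP ar).
rewrite -mul_mx_scalar -mulmxBr -mulmxA (mulmxA (conjtr M)) -/G mulmxA.
by rewrite [_ *m G]mulmxBl GG mul_scalar_mx subrr mul0mx.
Qed.

Lemma gram_ETF m n (M : 'M[C]_(m, n)) (a d w : C) :
  let G := conjtr M *m M in
  0 < a -> d != 0 -> (forall i, G i i = d) ->
  (forall i j, i <> j -> `|G i j| = w) -> G *m G = a *: G -> is_ETF M.
Proof.
move=> G a0 d0 Gd Gw GG; split.
- move=> i Mi0; move/eqP: d0; apply; rewrite -(Gd i) -cdot_col Mi0.
  by rewrite /cdot big1 // => k _; rewrite mxE mulr0.
- by move=> i j; rewrite /cnorm !cdot_col -/G !Gd.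
- by exists w => i j ij; rewrite cdot_col Gw.
(* A vector of the span is x = M D^T, and the frame sum is M M^* x = M G D^T = a x. *)
exists a => // x /submxP[D xD].
have {xD} -> : x = M *m D^T by rewrite -[x]trmxK xD trmx_mul trmxK.
have -> : \sum_i cdot (col i M) (M *m D^T) *: col i M
          = M *m (conjtr M *m (M *m D^T)).
  apply/colP => k; rewrite mxE summxE; apply: eq_bigr => i _.
  rewrite !mxE mulrC; congr (_ * _); rewrite /cdot.
  by apply: eq_bigr => l _; rewrite !mxE.
by rewrite (mulmxA (conjtr M)) mulmxA (gram_sq (gtr0_real a0)) // scalemxAl.
Qed.

(** The matrix G / a is idempotent, so its rank is its trace; it has the rank of M because G = M^* M
    and a M = M G. *)
Lemma gram_rank m n (M : 'M[C]_(m, n)) (a : C) :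
  let G := conjtr M *m M in
  0 < a -> G *m G = a *: G -> a * (\rank M)%:R = \tr G.
Proof.
move=> G a0 GG; have an0 : a != 0 by rewrite gt_eqF.
have MG := gram_sq (gtr0_real a0) GG.
have -> : \rank M = \rank (a^-1 *: G).
  rewrite eqmx_scale ?invr_eq0 //; apply/eqP; rewrite eqn_leq mxrankM_maxr.
  by rewrite -(eqmx_scale M an0) -MG mxrankM_maxr.
rewrite mxrank_idem; first by rewrite mxtraceZ mulrA divff // mul1r.
by rewrite -scalemxAl -scalemxAr GG !scalerA -mulrA mulVf // mulr1.
Qed.

End GramMatrix.

(** * Characters as ring homomorphisms on the group ring *)

Section GroupRingEval.
Variables (C : numClosedFieldType) (G : finZmodType).
Local Notation CG := (groupring C G).

Lemma gmonoM (g h : G) : gmono g * gmono h = gmono (g + h) :> CG.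
Proof.
apply: gcoef_inj => k; rewrite gcoefM (bigD1 g) //= !gcoef_mono eqxx mul1r.
rewrite big1 => [|i /negbTE ig]; last by rewrite gcoef_mono ig mul0r.
by rewrite addr0 subr_eq addrC.
Qed.

Lemma gcoef_conj (x : CG) g : gcoef (gconj x) g = Num.conj (gcoef x (- g)).
Proof. by rewrite {1}/gcoef ffunE. Qed.

Lemma gconj_mono (g : G) : gconj (gmono g) = gmono (- g) :> CG.
Proof.
apply: gcoef_inj => h; rewrite gcoef_conj !gcoef_mono.
by rewrite conjC_nat eqr_oppLR.
Qed.

Lemma gconj0 : gconj (0 : CG) = 0.
Proof. by apply: gcoef_inj => g; rewrite gcoef_conj /gcoef !ffunE conjC0. Qed.

Lemma gevalD (gamma : G -> C) (x y : CG) :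
  geval gamma (x + y) = geval gamma x + geval gamma y.
Proof.
by rewrite -big_split; apply: eq_bigr => g _; rewrite gcoefD mulrDl.
Qed.

Lemma geval0 (gamma : G -> C) : geval gamma (0 : CG) = 0.
Proof. by rewrite /geval big1 // => g _; rewrite /gcoef ffunE mul0r. Qed.

Lemma geval_mono (gamma : G -> C) g : geval gamma (gmono g) = gamma g.
Proof.
rewrite /geval (bigD1 g) //= gcoef_mono eqxx mul1r big1 ?addr0 //.
by move=> h /negbTE hg; rewrite gcoef_mono hg mul0r.
Qed.

Section Character.
Variables (gamma : G -> C) (hgamma : is_character gamma).

Lemma character0 : gamma 0 = 1.
Proof.
case: hgamma => norm1 morph.
have g0 : gamma 0 != 0 by rewrite -normr_eq0 norm1 oner_eq0.
by apply: (mulfI g0); rewrite -morph addr0 mulr1.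
Qed.

(** Both sides are inverse to [gamma g], which has modulus 1. *)
Lemma characterN g : gamma (- g) = Num.conj (gamma g).
Proof.
case: hgamma => norm1 morph.
have g0 : gamma g != 0 by rewrite -normr_eq0 norm1 oner_eq0.
apply: (mulfI g0); rewrite -morph subrr character0 -normCK norm1.
by rewrite expr1n.
Qed.

Lemma gevalM (x y : CG) : geval gamma (x * y) = geval gamma x * geval gamma y.
Proof.
case: hgamma => _ morph.
rewrite /geval; under eq_bigr do rewrite gcoefM mulr_suml.
rewrite exchange_big /= mulr_suml; apply: eq_bigr => h _.
rewrite mulr_sumr (reindex_inj (addIr h)) /=; apply: eq_bigr => k _.
by rewrite addrK morph; ring.
Qed.

Lemma geval_conj (x : CG) : geval gamma (gconj x) = Num.conj (geval gamma x).
Proof.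
rewrite /geval rmorph_sum (reindex_inj oppr_inj) /=; apply: eq_bigr => g _.
by rewrite rmorphM /= -characterN gcoef_conj opprK.
Qed.

Lemma evalmxM m n p (A : 'M[CG]_(m, n)) (B : 'M[CG]_(n, p)) :
  evalmx gamma (A *m B) = evalmx gamma A *m evalmx gamma B.
Proof.
apply/matrixP => i j; rewrite !mxE.
rewrite (big_morph _ (gevalD gamma) (geval0 gamma)).
by apply: eq_bigr => k _; rewrite gevalM !mxE.
Qed.

Lemma geval_nat n : geval gamma (n%:R : CG) = n%:R.
Proof.
elim: n => [|n IHn]; first exact: geval0.
rewrite -natr1 gevalD IHn (_ : 1 = gmono 0 :> CG) //.
by rewrite geval_mono character0 natr1.
Qed.

Lemma evalmx_gram m n (Phi : 'M[CG]_(m, n)) :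
  evalmx gamma (adjmx Phi *m Phi)
  = conjtr (evalmx gamma Phi) *m evalmx gamma Phi.
Proof.
rewrite evalmxM; congr (_ *m _).
by apply/matrixP => i j; rewrite !mxE geval_conj.
Qed.

(** Translating the summation by h multiplies the sum by [gamma h], which differs from 1. *)
Lemma sum_character : (exists g, gamma g <> 1) -> \sum_g gamma g = 0.
Proof.
case: hgamma => _ morph [h /eqP h1].
have hS : gamma h * \sum_g gamma g = \sum_g gamma g.
  rewrite [RHS](reindex_inj (addrI h)) mulr_sumr.
  by apply: eq_bigr => g _; rewrite morph.
apply/eqP; move/eqP: hS; rewrite -subr_eq0 -{2}[\sum_g _]mul1r -mulrBl.
by rewrite mulf_eq0 subr_eq0 (negbTE h1).
Qed.

End Character.
End GroupRingEval.

(** * The absolute trace in characteristic 2 and a real character *)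

Section Trace2.
Variables (F : finFieldType) (j : nat).
Hypotheses (j_gt0 : (0 < j)%N) (cardF : #|F| = (2 ^ j)%N).

Let tr (x : F) : F := \sum_(i < j) x ^+ (2 ^ i).

Let pchar2 : 2 \in [pchar F].
Proof. exact: card_finPcharP cardF isT. Qed.

Let trD x y : tr (x + y) = tr x + tr y.
Proof.
rewrite -big_split; apply: eq_bigr => i _ /=; apply: exprDn_pchar.
by rewrite (eq_pnat _ (pcharf_eq pchar2)) pnatX pnat_id.
Qed.

(** Squaring permutes the conjugates x^(2^i) cyclically since x^(2^j) = x, so the trace is a root of
    T^2 - T. To avoid the cyclic reindexing, x is added to both sides, and each becomes the sum of
    x^(2^i) over i <= j. *)
Let tr01 x : tr x = 0 \/ tr x = 1.
Proof.
have: tr x ^+ 2 = tr x.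
  rewrite -(pFrobenius_autE pchar2) rmorph_sum /=; apply: (@addrI _ x).
  have <- : \sum_(i < j.+1) x ^+ (2 ^ i) = x + tr x.
    by rewrite big_ord_recr /= -cardF expf_card addrC.
  rewrite big_ord_recl expn0 expr1; congr (_ + _); apply: eq_bigr => i _.
  by rewrite pFrobenius_autE -exprM /= /bump add1n expnSr.
move/eqP; rewrite -subr_eq0 expr2 -{3}[tr x]mulr1 -mulrBr mulf_eq0 subr_eq0.
by case/orP => /eqP; [left | right].
Qed.

(** The trace is a nonzero polynomial of degree less than 2^j = |F|, so it cannot vanish on all of
    F. *)
Let tr_neq0 : exists x, tr x != 0.
Proof.
pose p : {poly F} := \sum_(i < j) 'X^(2 ^ i).
have p0 : p != 0.
  (* The coefficient of X is 1: it comes from the term i = 0 alone, present as j > 0. *)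
  apply/eqP => /(congr1 (coefp 1)); rewrite /= coef0 coef_sum.
  rewrite (bigD1 (Ordinal j_gt0)) //= expn0 coefXn eqxx big1.
    by rewrite addr0 => /eqP; rewrite oner_eq0.
  move=> i i0; rewrite coefXn eq_sym gtn_eqF // -{1}(expn0 2) ltn_exp2l //.
  by rewrite lt0n; apply: contra i0 => /eqP i0; apply/eqP/val_inj.
have pE x : p.[x] = tr x.
  by rewrite horner_sum; apply: eq_bigr => i _; rewrite hornerXn.
have ps : (size p <= 2 ^ j)%N.
  apply: leq_trans (size_sum _ _ _) _; apply/bigmax_leqP => i _.
  by rewrite size_polyXn ltn_exp2l.
apply/existsP; apply: contraLR ps; rewrite negb_exists => /forallP tr0.
rewrite -ltnNge -cardF cardE; apply: max_poly_roots (enum_uniq _) => //.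
by apply/allP => x _; rewrite /root pE; have := tr0 x; rewrite negbK.
Qed.

Lemma real_nontrivial_character (C : numClosedFieldType) :
  exists2 gamma : F -> C, nontrivial_character gamma
                        & forall x, gamma x \is Num.real.
Proof.
have o0 : (1 == 0 :> F) = false by apply/negbTE/oner_neq0.
exists (fun x => if tr x == 0 then 1 else -1) => [|x]; last first.
  by case: ifP => _; rewrite ?rpredN rpred1.
split; last first.
  have [x /negbTE x0] := tr_neq0; exists x; rewrite x0 => /eqP.
  by rewrite eqNr oner_eq0.
split=> [x|x y]; first by case: ifP; rewrite ?normrN normr1.
rewrite trD; case: (tr01 x) => ->; case: (tr01 y) => ->;
  rewrite ?addr0 ?add0r ?eqxx ?o0 ?mulr1 ?mul1r //.
(* Both traces are 1: their sum is 0 in F, matching (-1)(-1) = 1. *)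
by rewrite -mulr2n -(pcharf0 pchar2) eqxx mulrNN mulr1.
Qed.

End Trace2.

(** * Lines of the affine plane over F and their phases *)

Section Geometry.
Variable F : finFieldType.
Local Notation point := (F * F)%type.
Local Notation line := (option F * F)%type.
Local Notation q := #|F|.

(** The line [(Some i, x)] is the graph y = x - i j, of slope -i; [(None, x)] is the vertical line j
    = x. *)
Definition incident (r : line) (c : point) : bool :=
  if r.1 is Some i then r.2 - c.2 == i * c.1 else r.2 == c.1.

Definition phase (r : line) (c : point) : F :=
  if r.1 is Some _ then c.1 * (r.2 + c.2) else 0.

Definition gram_phase (c c' : point) : F := (c'.1 - c.1) * (c.2 + c'.2).

Definition join_line (c c' : point) : line :=
  if c.1 == c'.1 then (None, c.1) else
  let i := (c'.2 - c.2) / (c.1 - c'.1) in (Some i, c.2 + i * c.1).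

(** The difference does not involve the line. With y = x - i j and y' = x - i j', j'(x + y') - j(x +
    y) = (j' - j)(2x - i(j + j')), whose last factor is y + y'. On a vertical line j = j' and both
    sides vanish. *)
Lemma phase_diff r c c' : incident r c -> incident r c' ->
  phase r c' - phase r c = gram_phase c c'.
Proof.
case: r c c' => [[i|] x] [j y] [j' y']; rewrite /incident /phase /gram_phase /=.
  move=> /eqP e /eqP e'; have -> : y = x - i * j by rewrite -e; ring.
  have -> : y' = x - i * j' by rewrite -e'; ring.
  ring.
by move=> /eqP <- /eqP <-; ring.
Qed.

Lemma incident_join r c c' : c != c' ->
  incident r c && incident r c' = (r == join_line c c').
Proof.
case: r c c' => [oi x] [j y] [j' y'] cc'; rewrite /incident /join_line /=.
have [ejj|njj] := eqVneq j j'.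
  have nyy : y != y' by apply: contra cc' => /eqP ->; rewrite ejj.
  case: oi => [i|]; last by rewrite -ejj andbb xpair_eqE eqxx.
  rewrite xpair_eqE /= -ejj; apply/negP => /andP[/eqP <-].
  by move/eqP/addrI/oppr_inj/eqP; rewrite eq_sym (negbTE nyy).
have d0 : j - j' != 0 by rewrite subr_eq0.
case: oi => [i|]; rewrite xpair_eqE /=; last first.
  by apply/negP => /andP[/eqP-> ]; rewrite (negbTE njj).
rewrite (inj_eq Some_inj).
apply/andP/andP => -[/eqP e1 /eqP e2]; last first.
  by rewrite e2 e1; split; apply/eqP; field.
(* Subtracting x - y' = i j' from x - y = i j determines i. *)
have ei : i = (y' - y) / (j - j').
  apply: (canRL (mulfK d0)); rewrite mulrBr -e1 -e2; ring.
rewrite -ei eqxx; split=> //; rewrite -e1; apply/eqP; ring.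
Qed.

Lemma card_line_points r : #|[set c | incident r c]| = q.
Proof.
case: r => [[i|] x].
  have inj : injective (fun j => (j, x - i * j)) by move=> j j' [].
  rewrite -cardsT -(card_imset _ inj); apply: eq_card => -[j y].
  rewrite inE /incident /=; apply/eqP/imsetP => [e|[k _ [-> ->]]]; last by ring.
  by exists j => //; rewrite -e; congr (_, _); ring.
have inj : injective (fun y : F => (x, y)) by move=> j j' [].
rewrite -cardsT -(card_imset _ inj); apply: eq_card => -[j y].
rewrite inE /incident /=; apply/eqP/imsetP => [->|[k _ [-> _]]] //.
by exists y.
Qed.

Lemma card_point_lines c : #|[set r | incident r c]| = q.+1.
Proof.
case: c => j y.
(* One line through the point for each of the q + 1 directions. *)
pose f oi := (oi, if oi is Some i then y + i * j else j).
have inj : injective f by move=> i i' [].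
rewrite -card_option -cardsT -(card_imset _ inj); apply: eq_card => -[[i|] x];
  rewrite inE /incident /=; apply/eqP/imsetP => [e|[[k|] _ []]] //.
- by exists (Some i) => //; rewrite /f -e; congr (_, _); ring.
- by move=> -> ->; ring.
- by exists None => //; rewrite /f -e.
Qed.

Definition line_set r : {set point} := [set c | incident r c].

(** A line has q >= 2 points, and two of them determine it. *)
Lemma line_set_inj : injective line_set.
Proof.
move=> r r' rr'.
have: (1 < #|line_set r|)%N by rewrite card_line_points finNzRing_gt1.
case/card_gt1P => c [c' [cr c'r cc']].
move: (cr) (c'r); rewrite rr' !inE => cr' c'r'; move: cr c'r; rewrite !inE.
move=> cr c'r; have := incident_join r cc'; have := incident_join r' cc'.
by rewrite cr c'r cr' c'r' => /esym/eqP -> /esym/eqP ->.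
Qed.

(** The ring is arbitrary so as to cover |Phi(z)|^2 over the group ring as well as |Phi(gamma)|^2
    over the complex numbers. *)
Lemma incident_BIBD (R : nzRingType) (M : 'M[R]_(#|{: line}|, #|{: point}|)) :
  (forall i j, M i j = (incident (enum_val i) (enum_val j))%:R) ->
  BIBD_incidence M (q ^ 2) q.
Proof.
move=> ME; have q1 : (1 < q)%N := finNzRing_gt1 F.
exists {: point}, [set line_set r | r : line]; split; last first.
  exists (line_set \o enum_val), enum_val; split.
  - by move=> i j /line_set_inj/enum_val_inj.
  - apply/setP => B; apply/imsetP/imsetP => -[r _ ->]; last first.
      by exists (enum_rank r); rewrite //= enum_rankK.
    by exists (enum_val r).
  - exact: enum_val_bij.
  - by move=> i j; rewrite ME inE.
split.
- by rewrite q1 -{1}[q]expn1 ltn_exp2l.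
- by rewrite card_prod mulnn.
- by move=> B /imsetP[r _ ->]; apply: card_line_points.
move=> c c' /eqP cc'; apply/eqP/cards1P; exists (line_set (join_line c c')).
apply/setP => B; rewrite !inE; apply/andP/eqP => [[/imsetP[r _ ->]]|->].
  by rewrite !inE incident_join // => /eqP ->.
by rewrite imset_f // !inE incident_join.
Qed.

End Geometry.

(** * The Gram matrix of Phi, its square, and the frame and DRACKN properties *)

Lemma sum_enum_val (V : nmodType) (T : finType) (f : T -> V) :
  \sum_(k < #|{: T}|) f (enum_val k) = \sum_x f x.
Proof. by rewrite [RHS](reindex enum_val (onW_bij _ (@enum_val_bij T))). Qed.

Section Phi.
Variables (C : numClosedFieldType) (F : finFieldType).
Local Notation point := (F * F)%type.
Local Notation CG := (groupring C F).
Local Notation q := #|F|.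
Local Notation Phi := (Phimx C F).
Local Notation gsum := (\sum_(g : F) gmono g : CG).

Lemma PhientryE r c :
  Phientry C r c = if incident r c then gmono (phase r c) else 0 :> CG.
Proof. by case: r c => [[i|] x] [j y]. Qed.

(** The entry sums over the lines through both points, and by [phase_diff] every line contributes
    the same monomial. There are q + 1 such lines for equal points and one otherwise. *)
Lemma Phimx_gramE k l :
  (adjmx Phi *m Phi) k l =
  if k == l then q.+1%:R else gmono (gram_phase (enum_val k) (enum_val l)).
Proof.
set c := enum_val k; set c' := enum_val l.
have -> : (adjmx Phi *m Phi) k l =
    \sum_(r | incident r c && incident r c') gmono (gram_phase c c').
  rewrite mxE [RHS]big_mkcond -[RHS]sum_enum_val /=.
  apply: eq_bigr => s _; rewrite !mxE !PhientryE.
  have := @phase_diff _ (enum_val s) c c'.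
  case: ifP => [_|_ _]; last by rewrite gconj0 mul0r.
  case: ifP => [_|_ _]; last by rewrite mulr0.
  by move=> /(_ isT isT) <-; rewrite gconj_mono gmonoM addrC.
rewrite -(inj_eq enum_val_inj) -/c -/c'; case: eqVneq => [<-|cc'].
  rewrite sumr_const /gram_phase subrr mul0r; congr (_ *+ _).
  rewrite -(card_point_lines c); apply: eq_card => r.
  by rewrite inE unfold_in andbb.
by rewrite (eq_bigl _ _ (fun r => incident_join r cc')) big_pred1_eq.
Qed.

(* The matrix A + I of the DRACKN A: its diagonal entries are z^0 = 1. *)
Definition phase_mx : 'M[CG]_(#|{: point}|) :=
  \matrix_(k, l) gmono (gram_phase (enum_val k) (enum_val l)).

Lemma Phimx_gram : adjmx Phi *m Phi = phase_mx + (q%:R)%:M.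
Proof.
apply/matrixP => k l; rewrite Phimx_gramE !mxE; case: eqVneq => [<-|_].
  by rewrite /gram_phase subrr mul0r mulr1n -nat1r.
by rewrite mulr0n addr0.
Qed.

Lemma sum_gmono_affine (a b : F) :
  b != 0 -> \sum_(g : F) gmono (a + g * b) = gsum.
Proof.
move=> b0; rewrite [RHS](reindex_inj (addrI a)) /=.
by rewrite [RHS](reindex_inj (mulIf b0)).
Qed.

Lemma phase_mx_sq :
  phase_mx *m phase_mx =
  ((q ^ 2)%:R)%:M + (q%:R * gsum) *: (const_mx 1 - 1%:M).
Proof.
apply/matrixP => k l; rewrite !mxE -(inj_eq enum_val_inj).
set c := enum_val k; set c' := enum_val l.
pose a := c'.1 * c'.2 - c.1 * c.2.
(* In the sum of the two phases through an intermediate point (j, y) the product j y cancels,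
   leaving an affine function of j and y. *)
pose f (p : point) : CG := gmono (a + p.1 * (c.2 - c'.2)
  + p.2 * (c'.1 - c.1)).
transitivity (\sum_p f p).
  rewrite -[RHS]sum_enum_val; apply: eq_bigr => s _; rewrite !mxE gmonoM.
  congr gmono; rewrite /gram_phase /a -/c -/c'; ring.
rewrite -(pair_bigA _ (fun j y => f (j, y))) /=.
case: (eqVneq c c') => [e|cc'].
  rewrite subrr mulr0 addr0 mulr1n.
  under eq_bigr => j _ do under eq_bigr => y _ do
    rewrite /f /a -e !subrr !(mulr0, mul0r) !addr0.
  by rewrite !sumr_const -mulrnA mulnn.
rewrite mulr0n add0r subr0 mulr1.
have sumq : \sum_(j : F) gsum = q%:R * gsum by rewrite sumr_const mulr_natl.
(* One of the two linear coefficients is nonzero. Summing over its coordinate first gives 1(z); the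
   other coordinate then contributes the factor q. *)
rewrite -sumq; have [e1|n1] := eqVneq c'.1 c.1.
  have n2 : c.2 - c'.2 != 0.
    rewrite subr_eq0; apply: contra cc' => /eqP e2.
    by rewrite [c]surjective_pairing [c']surjective_pairing e1 e2.
  rewrite exchange_big; apply: eq_bigr => y _ /=.
  rewrite -[RHS](sum_gmono_affine a n2).
  by apply: eq_bigr => j _; rewrite /f e1 subrr mulr0 addr0.
apply: eq_bigr => j _; rewrite -subr_eq0 in n1.
by rewrite -[RHS](sum_gmono_affine (a + j * (c.2 - c'.2)) n1).
Qed.

Lemma Phimx_DRACKN :
  abelian_DRACKN (q ^ 2) q q (adjmx Phi *m Phi - (q.+1%:R)%:M).
Proof.
have -> : adjmx Phi *m Phi - (q.+1%:R)%:M = phase_mx - 1%:M.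
  by rewrite Phimx_gram -natr1 raddfD opprD /= addrA addrK.
have q1 : (1 < q)%N := finNzRing_gt1 F.
split.
- by rewrite card_prod mulnn expn_gt0 (ltnW q1).
- apply/matrixP => k l; rewrite !mxE [l == k]eq_sym.
  case: eqVneq => [->|_]; rewrite ?subr0.
    by rewrite /gram_phase subrr mul0r subrr gconj0.
  by rewrite gconj_mono /gram_phase; congr gmono; ring.
- by move=> k; rewrite !mxE eqxx /gram_phase subrr mul0r subrr.
- move=> k l /eqP/negbTE kl; rewrite !mxE kl mulr0n subr0.
  by exists (gram_phase (enum_val k) (enum_val l)).
have q2 : (q ^ 2)%:R = q%:R * q%:R :> CG by rewrite -natrM mulnn.
(* Here n - fc - 2 = -2, so the claim is the expansion of (E - I)^2 with E = [phase_mx]. *)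
rewrite !(mulmxBl, mulmxBr) !mul1mx !mulmx1 phase_mx_sq q2.
move: gsum (q%:R : CG) => s Q; apply/matrixP => k l; rewrite !mxE.
by case: eqVneq => _; rewrite ?(mulr1n, mulr0n); ring.
Qed.

Lemma Phimx_gram_sq (gamma : F -> C) : nontrivial_character gamma ->
  let M := evalmx gamma Phi in
  let G := conjtr M *m M in G *m G = (2 * q)%:R *: G.
Proof.
move=> [hgamma nontriv] /=; rewrite -!evalmx_gram // -evalmxM //.
apply/matrixP => k l.
have gsum0 : geval gamma gsum = 0.
  rewrite (big_morph _ (gevalD gamma) (geval0 gamma)).
  rewrite -[RHS](sum_character hgamma nontriv).
  by apply: eq_bigr => g _; rewrite geval_mono.
have q2 : (q ^ 2)%:R = q%:R * q%:R :> CG by rewrite -natrM mulnn.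
have two_q : (2 * q)%:R = q%:R + q%:R :> CG by rewrite -natrD addnn mul2n.
(* Expand (E + q)^2 using E^2 = q^2 I + q 1(z)(J - I); the last term dies at gamma. *)
have -> : (adjmx Phi *m Phi) *m (adjmx Phi *m Phi) =
    (2 * q)%:R *: (adjmx Phi *m Phi)
    + (q%:R * gsum) *: (const_mx 1 - 1%:M).
  rewrite Phimx_gram !(mulmxDl, mulmxDr) -scalar_mxM mul_mx_scalar.
  rewrite mul_scalar_mx phase_mx_sq q2 two_q.
  move: ((q%:R * gsum) *: _) => Z.
  rewrite scalerDr scale_scalar_mx mulrDl raddfD /= scalerDl addrA.
  by rewrite [LHS](ACl (3 * 4 * (1 * 5) * 2)).
set X := adjmx Phi *m Phi; rewrite [RHS]mxE 2![evalmx _ _ _ _]mxE.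
rewrite 6!mxE gevalD !gevalM // geval_nat // gsum0.
by rewrite mulr0 mul0r addr0.
Qed.

Lemma evalmx_gramE (gamma : F -> C) k l : is_character gamma ->
  let M := evalmx gamma Phi in
  (conjtr M *m M) k l =
  if k == l then q.+1%:R else gamma (gram_phase (enum_val k) (enum_val l)).
Proof.
move=> hgamma /=; rewrite -evalmx_gram // mxE Phimx_gramE.
by case: ifP => _; rewrite ?geval_nat // geval_mono.
Qed.

Lemma evalmx_Phimx_ETF (gamma : F -> C) :
  nontrivial_character gamma -> is_ETF (evalmx gamma Phi).
Proof.
move=> hg; have [hgamma _] := hg; have q0 : (0 < q)%N := ltnW (finNzRing_gt1 F).
apply: (@gram_ETF _ _ _ _ (2 * q)%:R q.+1%:R 1).
- by rewrite ltr0n muln_gt0 q0.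
- by rewrite pnatr_eq0.
- by move=> k; rewrite evalmx_gramE // eqxx.
- by move=> k l /eqP/negbTE kl; rewrite evalmx_gramE // kl; case: hgamma => ->.
- exact: Phimx_gram_sq.
Qed.

Lemma evalmx_Phimx_rank (gamma : F -> C) :
  nontrivial_character gamma -> \rank (evalmx gamma Phi) = 'C(q.+1, 2).
Proof.
move=> hg; have [hgamma _] := hg; have q0 : (0 < q)%N := ltnW (finNzRing_gt1 F).
have a0 : 0 < (2 * q)%:R :> C by rewrite ltr0n muln_gt0 q0.
have := gram_rank a0 (Phimx_gram_sq hg).
have -> : \tr (conjtr (evalmx gamma Phi) *m evalmx gamma Phi)
          = (q * q * q.+1)%:R.
  rewrite /mxtrace; under eq_bigr do rewrite evalmx_gramE // eqxx.
  by rewrite sumr_const card_ord card_prod -mulrnA mulnC.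
(* The trace identity reads 2 q d = q^2 (q + 1); cancel q. *)
move/eqP; rewrite -natrM eqr_nat => /eqP.
rewrite -mulnA [(2 * _)%N]mulnCA -mulnA => /eqP; rewrite eqn_pmul2l //.
by move=> /eqP e; rewrite bin2 /= mulnC -e mul2n doubleK.
Qed.

Lemma Phimx_polyphase_BIBD_ETF : polyphase_BIBD_ETF (q ^ 2) q q Phi.
Proof.
split=> // [i j||]; last exact: evalmx_Phimx_ETF.
  rewrite mxE PhientryE; case: ifP => _; last by right.
  by left; exists (phase (enum_val i) (enum_val j)).
apply: incident_BIBD => i j; rewrite !mxE PhientryE.
case: ifP => _; last by rewrite mulr0.
by rewrite gconj_mono gmonoM addNr.
Qed.

Lemma sqmx_Phimx_BIBD (gamma : F -> C) :
  is_character gamma -> BIBD_incidence (sqmx (evalmx gamma Phi)) (q ^ 2) q.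
Proof.
move=> hgamma; apply: incident_BIBD => i j; rewrite !mxE PhientryE.
case: ifP => _; last by rewrite geval0 normr0 expr0n.
by rewrite geval_mono; case: hgamma => -> _; rewrite expr1n.
Qed.

Lemma evalmx_Phimx_real (gamma : F -> C) :
  (forall g, gamma g \is Num.real) ->
  forall i j, evalmx gamma Phi i j \is Num.real.
Proof.
move=> gr i j; rewrite !mxE PhientryE; case: ifP => _; last first.
  by rewrite geval0 rpred0.
by rewrite geval_mono.
Qed.

End Phi.

(** * The generalized quadrangle *)

Section Quadrangle.
Variable F : finFieldType.
Local Notation point := (F * F)%type.
Local Notation line := (option F * F)%type.
Local Notation q := #|F|.
Local Notation vertex := (point * F)%type.
Local Notation block := (point + line * F)%type.

(* inl c is the block of I (x) 1^T indexed by c; inr (r, a) is row a of the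
   block row r of Phi(T), as (T^g) a b = 1 iff b = a - g. *)
Definition gq_incident (B : block) (p : vertex) : bool :=
  match B with
  | inl c => p.1 == c
  | inr (r, a) => incident r p.1 && (p.2 == a - phase r p.1)
  end.

Definition gq_block (B : block) : {set vertex} := [set p | gq_incident B p].

Definition gq_blocks : {set {set vertex}} := [set gq_block B | B : block].

(** An equation for lying in a common block that does not mention the block, by [collinearP]; it
    makes the projection axiom an equation over F. *)
Definition collinear (p p' : vertex) : bool :=
  (p.1 == p'.1) || (p.2 - p'.2 == gram_phase p.1 p'.1).

Lemma collinearP p p' :
  reflect (exists B, gq_incident B p && gq_incident B p') (collinear p p').
Proof.
case: p p' => [c b] [c' b']; rewrite /collinear /=.
apply: (iffP idP) => [|[[c0|[r a]]] /=].
- have [<- _|cc' /= /eqP e] := eqVneq c c'.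
    by exists (inl c); rewrite /= eqxx.
  have := incident_join (join_line c c') cc'; rewrite eqxx => /andP[r1 r2].
  (* The row is forced by requiring that the block contain the first vertex. *)
  exists (inr (join_line c c', b + phase (join_line c c') c)).
  rewrite /= r1 r2 /= addrK eqxx -subr_eq0 /=; apply/eqP.
  have := phase_diff r1 r2; rewrite -e => e'.
  have -> : b = b' + (phase (join_line c c') c' - phase (join_line c c') c).
    by rewrite e'; ring.
  by ring.
- by move=> /andP[/eqP -> /eqP ->]; rewrite eqxx.
move=> /andP[/andP[r1 /eqP ->] /andP[r2 /eqP ->]].
by rewrite -(phase_diff r1 r2) orbC; apply/orP; left; apply/eqP; ring.
Qed.

Lemma gq_join_unique B B' p p' : p != p' ->
  gq_incident B p -> gq_incident B p' ->
  gq_incident B' p -> gq_incident B' p' -> B = B'.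
Proof.
case: p p' => [c b] [c' b'].
(* A block [inr (r, a)] is a graph over the points of r, so it meets each fibre [inl c0] at most
   once. *)
have inlr c0 r a : (c, b) != (c', b') :> vertex ->
    gq_incident (inl c0) (c, b) -> gq_incident (inl c0) (c', b') ->
    gq_incident (inr (r, a)) (c, b) -> ~~ gq_incident (inr (r, a)) (c', b').
  move=> ne /= /eqP cc0 /eqP c'c0 /andP[_ /eqP eb]; move: ne.
  rewrite xpair_eqE cc0 c'c0 eqxx => bb'.
  by rewrite -cc0 -eb negb_and [b' == b]eq_sym bb' orbT.
case: B B' => [c0|[r a]] [c1|[r' a']] ne h1 h2 h3 h4.
- by congr inl; rewrite -(eqP h1) -(eqP h3).
- by move: (inlr c0 r' a' ne h1 h2 h3); rewrite h4.
- by move: (inlr c1 r a ne h3 h4 h1); rewrite h2.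
case/andP: h1 h2 h3 h4 => /= r1 /eqP eb /andP[r2 /eqP eb'].
move=> /andP[r1' /eqP fb] /andP[r2' /eqP fb'].
have cc' : c != c'.
  by apply: contra ne => /eqP ec; rewrite xpair_eqE eb eb' ec !eqxx.
have rr' : r = r'.
  have := incident_join r cc'; rewrite r1 r2 => /esym/eqP ->.
  by have := incident_join r' cc'; rewrite r1' r2' => /esym/eqP ->.
rewrite rr' (_ : a = a') //; apply: (addIr (- phase r c)).
by rewrite -eb fb rr'.
Qed.

Lemma card_gq_block B : #|gq_block B| = q.
Proof.
case: B => [c|[r a]].
  have inj : injective (fun b : F => (c, b)) by move=> b b' [].
  rewrite -cardsT -(card_imset _ inj); apply: eq_card => -[c' b].
  rewrite inE /=; apply/eqP/imsetP => [->|[b' _ [-> _]]] //.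
  by exists b.
have inj : injective (fun c => (c, a - phase r c)) by move=> c c' [].
rewrite -(card_line_points r) -(card_imset _ inj); apply: eq_card => -[c b].
rewrite inE /=; apply/andP/imsetP => [[rc /eqP ->]|[c' + [-> ->]]].
  by exists c; rewrite ?inE.
by rewrite inE.
Qed.

Lemma gq_block_meet B B' : B <> B' -> (#|gq_block B :&: gq_block B'| <= 1)%N.
Proof.
move=> BB'; rewrite leqNgt; apply/negP => /card_gt1P[p [p' []]].
rewrite !inE => /andP[h1 h2] /andP[h3 h4] pp'.
exact: BB' (gq_join_unique pp' h1 h3 h2 h4).
Qed.

Lemma gq_block_inj : injective gq_block.
Proof.
move=> B B' e; apply/eqP/negPn/negP => /eqP/gq_block_meet.
by rewrite -e setIid card_gq_block leqNgt finNzRing_gt1.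
Qed.

(** The fibre of the vertex, and for each of the q + 1 lines through its point the one row that
    contains it. *)
Lemma card_vertex_blocks p : #|[set B in gq_blocks | p \in B]| = q.+2.
Proof.
have -> : [set B in gq_blocks | p \in B]
    = gq_block @: [set B | gq_incident B p].
  apply/setP => S; rewrite inE; apply/andP/imsetP => [[/imsetP[B _ ->]]|].
    by rewrite inE => Bp; exists B; rewrite ?inE.
  by case=> B + ->; rewrite !inE => Bp; rewrite imset_f.
rewrite (card_imset _ gq_block_inj).
have inj : injective (fun r => inr (r, p.2 + phase r p.1) : block).
  by move=> r r' [].
have -> : [set B | gq_incident B p] =
    inl p.1 |: [set inr (r, p.2 + phase r p.1) | r in [set r | incident r p.1]].
  apply/setP => -[c|[r a]]; rewrite !inE /=.
    rewrite (inj_eq inl_inj) eq_sym; apply/esym/orb_idr.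
    by case/imsetP.
  apply/andP/imsetP => [[rp /eqP ->]|[r' + [-> ->]]]; last first.
    by rewrite inE addrK.
  by exists r; rewrite ?inE // subrK.
rewrite cardsU1 (card_imset _ inj) card_point_lines.
by case: imsetP => // -[].
Qed.

Lemma gq_projection p B : ~~ gq_incident B p ->
  exists p', [/\ gq_incident B p', collinear p p' &
    forall p'', gq_incident B p'' -> collinear p p'' -> p'' = p'].
Proof.
case: p B => [c b] [c0|[r a]] /= nB.
  exists (c0, b - gram_phase c c0); rewrite /collinear /= eqxx subKr eqxx orbT.
  split=> // -[c1 b1] /= /eqP ->; rewrite (negbTE nB) /= => /eqP <-.
  by rewrite subKr.
(* If c lies on r, the projection is the vertex of the block over c: a collinear vertex of the block
   over another point would, by [phase_diff], put (c, b) itself in the block. *)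
have [rc|nrc] := boolP (incident r c).
  exists (c, a - phase r c); rewrite /collinear /= rc !eqxx; split=> //.
  move=> [c1 b1] /= /andP[rc1 /eqP ->]; case: eqVneq => [<- //|_] /= /eqP e.
  rewrite rc /= in nB; case/eqP: nB; apply: (addrI (- b)).
  have {}e := etrans e (esym (phase_diff rc rc1)).
  have -> : b = a - phase r c1 + (phase r c1 - phase r c) by rewrite -e; ring.
  by ring.
have coll c1 b1 : incident r c1 ->
    collinear (c, b) (c1, b1) = (b - b1 == gram_phase c c1).
  rewrite /collinear /= => rc1; case: eqVneq => // cc1.
  by rewrite cc1 rc1 in nrc.
case: r c nB nrc coll => [[i|] x] [j y] _; rewrite /incident /= => nrc coll.
  have d0 : y - x + i * j != 0.
    apply: contra nrc => /eqP e; rewrite -subr_eq0 -oppr_eq0; apply/eqP.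
    by rewrite -e; ring.
  (* Substituting y1 = x - i j1 and b1 = a - j1 (x + y1) into b - b1 = (j1 - j)(y + y1), the terms
     in j1^2 cancel. The remaining coefficient of j1 is nonzero because c is off the line. *)
  pose j1 := (b - a + j * y + j * x) / (y - x + i * j).
  have j1E : j1 * (y - x + i * j) = b - a + j * y + j * x by rewrite divfK.
  exists ((j1, x - i * j1), a - j1 * (x + (x - i * j1))).
  have rc1 : x - (x - i * j1) == i * j1 by rewrite subKr.
  split; first by rewrite /= /phase /= rc1 /= eqxx.
    rewrite coll //= /gram_phase /= -subr_eq0; apply/eqP.
    have -> : b = j1 * (y - x + i * j) + a - j * y - j * x by rewrite j1E; ring.
    by ring.
  move=> [[j2 y2] b2] /= /andP[rc2 /eqP ->]; rewrite coll //= => /eqP e.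
  have ey2 : y2 = x - i * j2 by rewrite -(eqP rc2) subKr.
  have ej : j2 = j1.
    apply: (mulIf d0); rewrite j1E; move: e; rewrite /phase /gram_phase /= ey2.
    move/eqP; rewrite -subr_eq0 => /eqP e; apply/eqP; rewrite -subr_eq0.
    rewrite -oppr_eq0; apply/eqP; rewrite -[RHS]e; ring.
  by rewrite ey2 ej.
have d0 : x - j != 0 by rewrite subr_eq0.
(* On a vertical line the phase is 0 and the abscissa is x, so collinearity reads b - a = (x - j)(y
   + y1). *)
pose y1 := (b - a) / (x - j) - y.
have y1E : (x - j) * (y + y1) = b - a.
  by rewrite /y1 [y + _]addrC subrK mulrC divfK.
exists ((x, y1), a); split; first by rewrite /= /phase /= subr0 !eqxx.
  by rewrite coll //= /gram_phase /= y1E.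
move=> [[j2 y2] b2] /= /andP[/eqP <-]; rewrite /phase /= subr0 => /eqP ->.
by rewrite coll //= /gram_phase /= -y1E => /eqP/(mulfI d0)/addrI <-.
Qed.

Lemma gq_blocks_GQ : is_GQ gq_blocks q.-1 q.+1.
Proof.
have q1 : (1 < q)%N := finNzRing_gt1 F.
split.
- by rewrite -subn1 subn_gt0 q1.
- by move=> B /imsetP[B' _ ->]; rewrite card_gq_block prednK // ltnW.
- exact: card_vertex_blocks.
- split=> [B B' /imsetP[D _ ->] /imsetP[D' _ ->] DD'|p p' /eqP pp'].
    by apply: gq_block_meet => e; apply: DD'; rewrite e.
  rewrite leqNgt; apply/negP => /card_gt1P[B [B' []]]; rewrite !inE.
  move=> /andP[/imsetP[D _ ->]]; rewrite !inE => /andP[h1 h2].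
  move=> /andP[/imsetP[D' _ ->]]; rewrite !inE => /andP[h3 h4].
  by rewrite (gq_join_unique pp' h1 h2 h3 h4) eqxx.
move=> p S /imsetP[B _ ->{S}]; rewrite inE => nBp.
have [p' [Bp' /collinearP[B' /andP[B'p B'p']] uniq_p']] := gq_projection nBp.
exists (p', gq_block B'); split; first by rewrite /= !inE imset_f.
move=> [p2 S] /= [/imsetP[B2 _ ->{S}]]; rewrite !inE => Bp2 B2p2 B2p.
have e : p2 = p'.
  by apply: uniq_p' => //; apply/collinearP; exists B2; rewrite B2p B2p2.
(* The vertex is now unique; the block is too, as it joins two distinct vertices. *)
rewrite e in B2p2 *; have pp' : p != p'.
  by apply: contraNneq nBp => ->.
by rewrite (gq_join_unique pp' B'p B'p' B2p B2p2).
Qed.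

Lemma blockmx_Phimx (C : numClosedFieldType) k l :
  let r := enum_val (mxtens_unindex k).1 in
  let a := enum_val (mxtens_unindex k).2 in
  let p := (enum_val (mxtens_unindex l).1, enum_val (mxtens_unindex l).2) in
  blockmx (Phimx C F) k l = (gq_incident (inr (r, a)) p)%:R.
Proof.
rewrite /= mxE /gtransmx summxE mxE PhientryE.
case: ifP => _; last by rewrite big1 // => g _; rewrite !mxE /gcoef ffunE mul0r.
set g := phase _ _.
rewrite (bigD1 g) //= big1 => [|h /negbTE hg].
  by rewrite !mxE gcoef_mono eqxx mul1r addr0.
by rewrite !mxE gcoef_mono hg mul0r.
Qed.

Lemma GQmx_Phimx (C : numClosedFieldType) :
  is_incidence_matrix (GQmx (Phimx C F)) gq_blocks.
Proof.
(* The two summands are the two stacked parts of Z; the factor 1 comes from the single row of the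
   all-ones vector. *)
pose blk (k : 'I_(#|{: point}| * 1 + #|{: line}| * q)) : block :=
  match split k with
  | inl k1 => inl (enum_val (mxtens_unindex k1).1)
  | inr k2 => let u := mxtens_unindex k2 in inr (enum_val u.1, enum_val u.2)
  end.
pose blk_inv (B : block) : 'I_(#|{: point}| * 1 + #|{: line}| * q) :=
  match B with
  | inl c => lshift _ (mxtens_index (enum_rank c, ord0))
  | inr (r, a) => rshift _ (mxtens_index (enum_rank r, enum_rank a))
  end.
have blkK : cancel blk blk_inv.
  move=> k; rewrite /blk; case: splitP => k1 ek; apply: val_inj.
    rewrite [RHS]ek; case: (mxtens_indexP k1) => i j.
    by rewrite mxtens_indexK /= !enum_valK (ord1 j).
  rewrite [RHS]ek; case: (mxtens_indexP k1) => i j.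
  by rewrite mxtens_indexK /= !enum_valK.
have blk_invK : cancel blk_inv blk.
  move=> [c|[r a]]; rewrite /blk /blk_inv.
    by rewrite (unsplitK (inl _)) mxtens_indexK enum_rankK.
  by rewrite (unsplitK (inr _)) mxtens_indexK /= !enum_rankK.
pose vx (l : 'I_(#|{: point}| * q)) : vertex :=
  (enum_val (mxtens_unindex l).1, enum_val (mxtens_unindex l).2).
exists (gq_block \o blk), vx; split.
- exact: inj_comp gq_block_inj (can_inj blkK).
- apply/setP => S; apply/imsetP/imsetP => -[B _ ->]; first by exists (blk B).
  by exists (blk_inv B); rewrite //= blk_invK.
- exists (fun p => mxtens_index (enum_rank p.1, enum_rank p.2)) => [l|[c b]].
    by case: (mxtens_indexP l) => i j; rewrite /vx mxtens_indexK /= !enum_valK.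
  by rewrite /vx mxtens_indexK /= !enum_rankK.
move=> k l; rewrite inE /= /blk /GQmx mxE; case: splitP => k1 _.
  by rewrite !mxE mulr1 /= (inj_eq enum_val_inj) eq_sym.
by rewrite blockmx_Phimx.
Qed.

Lemma Phimx_abelian_GQ (C : numClosedFieldType) :
  is_abelian_GQ C gq_blocks (q - 1) (q + 1).
Proof.
have q1 : (1 <= q)%N := ltnW (finNzRing_gt1 F).
split; first by rewrite subn1 addn1; apply: gq_blocks_GQ.
exists F, _, _, (Phimx C F); split; last exact: GQmx_Phimx.
rewrite subnK //; have -> : ((q - 1) * (q + 1) + 1 = q ^ 2)%N.
  by rewrite -subn_sqr exp1n subnK // expn_gt0 q1.
exact: Phimx_polyphase_BIBD_ETF.
Qed.

End Quadrangle.

(** * The binomial count of n - d and the assembly of the assertions *)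

Lemma bin2_add_bin2 n : ('C(n, 2) + 'C(n.+1, 2) = n ^ 2)%N.
Proof.
rewrite binS bin1 addnA addnn bin2 halfK oddM; case: n => //= n.
by rewrite andNb subn0 -mulnSr mulnn.
Qed.

Theorem theorem5p1 (R : realType) (q : nat) (F : finFieldType)
    (hq : #|F| = q) :
  let C : numClosedFieldType := R[i] in
  let Phi := Phimx C F in
  polyphase_BIBD_ETF (q ^ 2) q q Phi /\
  [/\ (* (a) *)
      (forall gamma : F -> C, nontrivial_character gamma ->
        let n := #|{: F * F}| in
        let d := \rank (evalmx gamma Phi) in
        BIBD_incidence (sqmx (evalmx gamma Phi)) (q ^ 2) q /\
        [/\ is_ETF (evalmx gamma Phi), d = 'C(q.+1, 2), n = (q ^ 2)%N
          & (n - d)%N = 'C(q, 2)]),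
      (* (b) *)
      (forall j : nat, (0 < j)%N -> q = (2 ^ j)%N ->
        exists2 gamma : F -> C, nontrivial_character gamma
          & is_real_ETF (evalmx gamma Phi)),
      (* (c) *)
      abelian_DRACKN (q ^ 2) q q (adjmx Phi *m Phi - (q.+1%:R)%:M)
    & (* (d) *)
      exists (V : finType) (Bs : {set {set V}}),
        is_abelian_GQ C Bs (q - 1) (q + 1) /\
        is_incidence_matrix (GQmx Phi) Bs].
Proof.
move=> C Phi; subst q; split; first exact: Phimx_polyphase_BIBD_ETF.
have card_n : #|{: F * F}| = (#|F| ^ 2)%N by rewrite card_prod mulnn.
split.
- move=> gamma hgamma n d; have dE : d = 'C(#|F|.+1, 2).
    exact: evalmx_Phimx_rank.
  split; first by apply: sqmx_Phimx_BIBD; case: hgamma.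
  split=> //; first exact: evalmx_Phimx_ETF.
  by rewrite dE /n card_n -bin2_add_bin2 addnK.
- move=> j j0 cardF; have [gamma hgamma gamma_real] :=
    real_nontrivial_character j0 cardF C.
  exists gamma => //; split; first exact: evalmx_Phimx_real.
  exact: evalmx_Phimx_ETF.
- exact: Phimx_DRACKN.
exists _, (gq_blocks F); split; first exact: Phimx_abelian_GQ.
exact: GQmx_Phimx.
Qed.
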